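(* Let $X$ be a Banach space and let $(x_k)$ be a bounded sequence in $X$. Then \[ \widetilde{\delta}(x_k)\leq 2\,\widehat{\operatorname{d}}(\operatorname{clust}_{X^{**}}(x_k), X). \] If, moreover, $X$ is $L$-embedded, then also \[ 2\,\widehat{\operatorname{d}}(\operatorname{clust}_{X^{**}}(x_k), X)\leq \delta_X(x_k) \qquad\text{and}\qquad 2\,\operatorname{d}(\operatorname{clust}_{X^{**}}(x_k),X)\leq \widetilde{\delta}(x_k). \]
   Context: Banach spaces are real. $X$ is identified with its canonical image in the bidual $X^{**}$. For a bounded sequence $(x_k)$ in $X$, $\operatorname{clust}_{X^{**}}(x_k)$ denotes the set of all weak$^*$ cluster points of $(x_k)$ in $X^{**}$, and $\delta_X(x_k)$ denotes the diameter (in the norm of $X^{**}$) of this set; equivalently $\delta_X(x_k)=\sup_{x^*\in B_{X^*}}\big(\limsup_k x^*(x_k)-\liminf_k x^*(x_k)\big)$. Further, $\widetilde{\delta}(x_k)=\inf\{\delta_X(x_{k_j}) : (x_{k_j}) \text{ a subsequence of } (x_k)\}$. For nonempty subsets $A,B$ of a Banach space, $\operatorname{d}(A,B)=\inf\{\|a-b\|: a\in A, b\in B\}$ and $\widehat{\operatorname{d}}(A,B)=\sup\{\operatorname{d}(a,B): a\in A\}$. A Banach space $X$ is $L$-embedded if there is a projection $P$ of $X^{**}$ onto $X$ such that $\|x^{**}\|=\|Px^{**}\|+\|x^{**}-Px^{**}\|$ for all $x^{**}\in X^{**}$. *)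

(* Defs.v *)
From HB Require Import structures.
From mathcomp Require Import all_boot all_order all_algebra.
From mathcomp Require Import all_classical all_reals all_analysis.
Set Implicit Arguments. Unset Strict Implicit. Unset Printing Implicit Defensive.
Import Order.TTheory GRing.Theory Num.Theory.
Import numFieldNormedType.Exports.
Local Open Scope classical_set_scope.
Local Open Scope ring_scope.

Section Bidual.
Context {R : realType} {X : normedModType R}.

Definition dual : set (X -> R) :=
  [set f | (forall (a : R) (x y : X), f (a *: x + y) = a * f x + f y)
           /\ continuous f].

Definition dual_ball : set (X -> R) :=
  [set f | dual f /\ forall x : X, `|f x| <= `|x|].

(* Xbidual : bounded linear functionals on Xdual (only values on Xdual matter) *)
Definition bidual : set ((X -> R) -> R) :=
  [set Phi | (forall (a : R) (f g : X -> R), dual f -> dual g ->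
                 Phi (fun x => a * f x + g x) = a * Phi f + Phi g)
             /\ exists C : R, forall f, dual_ball f -> `|Phi f| <= C].

Definition bnorm (Phi : (X -> R) -> R) : \bar R :=
  ereal_sup [set (`|Phi f|)%:E | f in dual_ball].

Definition embed (x : X) : (X -> R) -> R := fun f => f x.

Definition bsub (Phi Psi : (X -> R) -> R) : (X -> R) -> R :=
  fun f => Phi f - Psi f.

Definition wstar_cluster (u : nat -> X) (Phi : (X -> R) -> R) : Prop :=
  bidual Phi /\
  forall (n : nat) (F : 'I_n -> (X -> R)) (e : R),
    (forall i, dual (F i)) -> 0 < e ->
    forall N : nat, exists k : nat, (N <= k)%N /\
      forall i, `|F i (u k) - Phi (F i)| < e.

Definition clust (u : nat -> X) : set ((X -> R) -> R) := wstar_cluster u.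

Definition diam (A : set ((X -> R) -> R)) : \bar R :=
  ereal_sup [set r | exists Phi Psi, A Phi /\ A Psi /\ r = bnorm (bsub Phi Psi)].

Definition deltaX (u : nat -> X) : \bar R := diam (clust u).

Definition delta_tilde (u : nat -> X) : \bar R :=
  ereal_inf [set deltaX (u \o phi) | phi in
               [set phi : nat -> nat | forall m n, (m < n)%N -> (phi m < phi n)%N]].

Definition dist_X (Phi : (X -> R) -> R) : \bar R :=
  ereal_inf [set bnorm (bsub Phi (embed x)) | x in [set: X]].

Definition dset_X (A : set ((X -> R) -> R)) : \bar R :=
  ereal_inf [set r | exists Phi x, A Phi /\ r = bnorm (bsub Phi (embed x))].

Definition dhat_X (A : set ((X -> R) -> R)) : \bar R :=
  ereal_sup [set dist_X Phi | Phi in A].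

End Bidual.

Definition L_embedded (R : realType) (X : normedModType R) : Prop :=
  exists P : ((X -> R) -> R) -> X,
    (forall (a : R) Phi Psi, bidual Phi -> bidual Psi ->
       P (fun f => a * Phi f + Psi f) = a *: P Phi + P Psi) /\
    (forall x : X, P (embed x) = x) /\
    (forall Phi, bidual Phi ->
       bnorm Phi = (bnorm (embed (P Phi)) + bnorm (bsub Phi (embed (P Phi))))%E).

(* Main.v *)
Require Import Defs.
From HB Require Import structures.
From mathcomp Require Import all_boot all_order all_algebra.
From mathcomp Require Import all_classical all_reals all_analysis.
From mathcomp Require Import zify ring lra.
Import Order.TTheory GRing.Theory Num.Theory.
Import numFieldNormedType.Exports.
Local Open Scope classical_set_scope.
Local Open Scope ring_scope.
Set Implicit Arguments.
Unset Strict Implicit.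
Unset Printing Implicit Defensive.

(* First inequality: if every subsequence has delta > 2c, then for some rationals
   p < q with q - p >= 2c Rosenthal's combinatorial argument yields a subsequence
   (w_k) for which the pairs of sets {q < f(w_k)}, {f(w_k) < p} of functionals f in
   the dual ball are independent. Every weak* cluster point Phi of (w_k) is then at
   distance >= c from X: given x, there are f, g in the ball with f(x), g(x)
   arbitrarily close, f(w_k) >= q and g(w_k) <= p for large k, hence
   Phi(f) - Phi(g) >= q - p.

   L-embedded case: let Phi be a cluster point, x = P Phi and Psi = Phi - x. Since
   |y + a Psi| = |y| + |a| |Psi| for y in X, any functional in the dual ball can be
   perturbed, with little change on a given finite subset of X, so that its value
   at Psi is close to |Psi| or to -|Psi|, as desired. Alternating the signs while
   picking terms of the sequence on which the functional is close to its value at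
   Phi, one gets a functional f such that f(u_k) - f(x) is nearly >= |Psi|
   infinitely often and nearly <= -|Psi| infinitely often. *)

(** * Rosenthal's dichotomy for pairs of sets *)

Definition unbounded (M : set nat) := forall N, exists2 k, (N <= k)%N & M k.

Lemma unbounded_gt M j : unbounded M -> unbounded (M `&` [set k | (j < k)%N]).
Proof.
move=> iM N; have [k lek Mk] := iM (maxn N j.+1); exists k; first by lia.
by split=> //=; lia.
Qed.

Lemma increasing_ge_id (j : nat -> nat) :
  (forall m n, (m < n)%N -> (j m < j n)%N) -> forall n, (n <= j n)%N.
Proof. by move=> jlt; elim=> // n IH; apply: leq_ltn_trans IH _; apply: jlt. Qed.

Definition history (j : nat -> nat) n := rev (mkseq j n).

Lemma historyS j n : history j n.+1 = j n :: history j n.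
Proof. by rewrite /history mkseqS rev_rcons. Qed.

Lemma size_history j n : size (history j n) = n.
Proof. by rewrite size_rev size_mkseq. Qed.

(* Dependent choice for diagonal arguments: the invariant Q ties the finite
   history j (n-1), ..., j 0 (newest first) to an infinite reservoir containing
   all later j m. *)
Lemma fusion (Q : seq nat -> set nat -> Prop) (M0 : set nat) :
  unbounded M0 -> Q [::] M0 ->
  (forall h M, unbounded M -> Q h M -> exists j M',
     [/\ M j, unbounded M', M' `<=` M `&` [set k | (j < k)%N] & Q (j :: h) M']) ->
  exists j : nat -> nat, [/\ forall m n, (m < n)%N -> (j m < j n)%N,
    forall n, M0 (j n) &
    forall n, exists2 M, Q (history j n) M & forall m, (n <= m)%N -> M (j m)].
Proof.
move=> iM0 Q0 step.
pose ok (st : seq nat * set nat) := unbounded st.2 /\ Q st.1 st.2.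
pose T := {st | ok st}.
pose rel (a b : T) := exists j, [/\ (sval b).1 = j :: (sval a).1,
  (sval a).2 j & (sval b).2 `<=` (sval a).2 `&` [set k | (j < k)%N]].
have tot a : {b | rel a b}.
  apply: cid; case: a => -[h M] [/= iM QM].
  have [j [M' [Mj iM' sM' QM']]] := step h M iM QM.
  by exists (exist _ (j :: h, M') (conj iM' QM')), j.
have [F [F0 FS]] := dependent_choice tot (exist ok ([::], M0) (conj iM0 Q0)).
have [j jP] := choice FS; exists j.
have FE n : (sval (F n)).1 = history j n.
  elim: n => [|n IH]; first by rewrite F0.
  by rewrite historyS -IH; have [] := jP n.
have FM m n : (n <= m)%N -> (sval (F m)).2 `<=` (sval (F n)).2.
  elim: m => [|m IH]; first by rewrite leqn0 => /eqP ->.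
  rewrite leq_eqVlt => /predU1P[->//|]; rewrite ltnS => /IH.
  by apply: subset_trans; have [_ _] := jP m; move=> s k /s[].
have jM n m : (n <= m)%N -> (sval (F n)).2 (j m).
  by move=> lenm; apply: (FM _ _ lenm); have [] := jP m.
split.
- move=> m n ltmn; have [_ _ sM] := jP m.
  by have /sM[] := jM _ _ ltmn.
- by move=> n; have := jM 0%N n isT; rewrite F0.
- move=> n; exists (sval (F n)).2; last exact: jM.
  by rewrite -FE; have [] := svalP (F n).
Qed.

(** Induction on the number of colours. If some word [s] lacks colour [n], so do all its extensions,
    and the words extending [s] need one colour less; otherwise every word has colour [n]. Words
    grow on the left, as histories do. *)
Lemma colour_extension (n : nat) (col : seq bool -> nat -> Prop) :
  (forall t s c, col (t ++ s) c -> col s c) ->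
  (forall s, exists2 c, (c < n)%N & col s c) ->
  exists s c, forall t, col (t ++ s) c.
Proof.
elim: n col => [|n IH] col sub tot; first by have [] := tot [::].
have [[s ns]|alls] := pselect (exists s, ~ col s n); last first.
  by exists [::], n => t; apply: contrapT => nt; apply: alls; exists (t ++ [::]).
have [t s' c|t|s' [c cP]] := IH (fun t => col (t ++ s)).
- by rewrite -catA; apply: sub.
- have [c ltc cc] := tot (t ++ s); exists c => //.
  rewrite ltnS leq_eqVlt in ltc; case/predU1P: ltc cc => // -> /sub /ns [].
- by exists (s' ++ s), c => t; rewrite catA.
Qed.

Section Rosenthal.
Variables (T : Type) (E : bool -> nat -> set T).
Implicit Types (V : set T) (M : set nat).

(** For the level sets of functionals used below, this says that the values along [M] do not
    oscillate infinitely often across the gap from p to q. *)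
Definition converges V M := forall f, V f ->
  exists b, ~ unbounded [set k | M k /\ E b k f].

Definition oscillates V M :=
  forall M', M' `<=` M -> unbounded M' -> ~ converges V M'.

Lemma oscillates_sub V M M' : M' `<=` M -> oscillates V M -> oscillates V M'.
Proof. by move=> sM oV M'' sM'; apply: oV; apply: subset_trans sM. Qed.

Lemma converges_tail V M M' N :
  (forall k, (N <= k)%N -> M' k -> M k) -> converges V M -> converges V M'.
Proof.
move=> tail cV f /cV[b nb]; exists b => iM'; apply: nb => n.
have [k lek [Mk Ek]] := iM' (maxn N n); exists k; first by lia.
by split=> //; apply: tail => //; lia.
Qed.

(* Otherwise fusion yields b and j 0 < j 1 < ... such that the E b' (j m) converge
   on V inside each E b (j n); at the points of V outside all E b (j n) they
   converge trivially, so they converge on V. *)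
Lemma oscillates_split1 V M : unbounded M -> oscillates V M ->
  exists2 M', M' `<=` M & unbounded M' /\
    forall j b, M' j -> oscillates (V `&` E b j) M'.
Proof.
move=> iM oV; apply: contrapT => nM'.
pose Q h M' := M' `<=` M /\ if h is j :: _ then
  exists b, converges (V `&` E b j) M' else True.
have [||j [jlt jM jQ]] := fusion (Q := Q) iM.
- by split.
- move=> h M1 iM1 [sM1 _].
  have [j [b [M1j [M2 [sM2 iM2 cM2]]]]] : exists j b, M1 j /\ exists M2,
      [/\ M2 `<=` M1, unbounded M2 & converges (V `&` E b j) M2].
    apply: contrapT => no; apply: nM'; exists M1 => //; split=> // j b M1j.
    move=> M2 sM2 iM2 cM2; apply: no; exists j, b; split=> //.
    by exists M2.
  exists j, (M2 `&` [set k | (j < k)%N]); split=> //.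
  + exact: unbounded_gt.
  + by move=> k [/sM2].
  + split; first by move=> k [/sM2/sM1].
    by exists b; apply: (@converges_tail _ _ _ 0) cM2 => k _ [].
have {}jQ n : exists b, converges (V `&` E b (j n)) [set k | exists2 m, (n < m)%N & k = j m].
  have [M1] := jQ n.+1; rewrite historyS => -[_ [b cb]] M1j; exists b.
  by apply: (@converges_tail _ _ _ 0) cb => _ _ [m lem ->]; apply: M1j.
have jge := increasing_ge_id jlt.
have [b bP] := choice jQ.
have [e ie] : exists e, unbounded [set n | b n = e].
  apply: contrapT => no.
  have bnd e : exists N, forall n, (N <= n)%N -> b n <> e.
    apply: contrapT => ne; apply: no; exists e => N.
    apply: contrapT => nN; apply: ne; exists N => n leN bn.
    by apply: nN; exists n.
  have [[N1 h1] [N2 h2]] := (bnd true, bnd false).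
  case E0: (b (maxn N1 N2)); first by apply: h1 E0; lia.
  by apply: h2 E0; lia.
pose N := [set k | exists2 n, b n = e & k = j n].
have iN : unbounded N.
  move=> m; have [n len bn] := ie m; exists (j n); last by exists n.
  exact: leq_trans (jge n).
apply: (oV N _ iN) => [_ [n _ ->]//|f Vf].
have [nu|/contrapT u] := pselect (~ unbounded [set k | N k /\ E e k f]).
  by exists e.
have [_ _ [[n bn ->] Enf]] := u 0%N.
have := bP n; rewrite bn.
have tail k : (j n < k)%N -> N k -> [set k | exists2 m, (n < m)%N & k = j m] k.
  move=> ltk [m _ km]; exists m => //; rewrite ltnNge; apply/negP => lemn.
  by move: lemn ltk; rewrite km leq_eqVlt => /predU1P[->|/jlt]; lia.
by move=> /(converges_tail tail)/(_ f); apply.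
Qed.

(** The sets are treated one after another; thinning the reservoir for one of them preserves what
    was gained for the others, as oscillation is hereditary. *)
Lemma oscillates_split (L : seq (set T)) M : unbounded M ->
  (forall V, V \in L -> oscillates V M) ->
  exists2 M', M' `<=` M & unbounded M' /\
    forall V j b, V \in L -> M' j -> oscillates (V `&` E b j) M'.
Proof.
move=> iM; elim: L => [|V L IH] oL; first by exists M.
have [|M1 sM1 [iM1 h1]] := IH; first by move=> W WL; apply: oL; rewrite in_cons WL orbT.
have oV : oscillates V M1 by apply: (oscillates_sub sM1); apply: oL; rewrite mem_head.
have [M2 sM2 [iM2 h2]] := oscillates_split1 iM1 oV.
exists M2; first exact: subset_trans sM1.
split=> // W j b; rewrite in_cons => /predU1P[->|WL M2j]; first exact: h2.
by apply: (oscillates_sub sM2); apply: h1 => //; apply: sM2.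
Qed.

(** The Boolean atom inside [V] that has pattern [s] along the indices [h], newest index first. *)
Fixpoint word V (h : seq nat) (s : seq bool) : set T :=
  match h, s with
  | k :: h', b :: s' => word V h' s' `&` E b k
  | _, _ => V
  end.

Fixpoint words V (h : seq nat) : seq (set T) :=
  if h is k :: h' then
    [seq W `&` E true k | W <- words V h'] ++ [seq W `&` E false k | W <- words V h']
  else [:: V].

Lemma mem_words V h s : size s = size h -> word V h s \in words V h.
Proof.
elim: h s => [|k h IH] [|b s] //=; first by rewrite mem_head.
move=> /succn_inj/IH; rewrite mem_cat => ws; apply/orP.
by case: b; [left|right]; apply/mapP; exists (word V h s).
Qed.

Lemma wordW V h s : word V h s `<=` V.
Proof. by elim: h s => [|k h IH] [|b s] //= f [/IH]. Qed.

(** Fusion with the invariant that every atom along the history still oscillates on the reservoir;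
    [oscillates_split] provides the next index. An oscillating atom cannot be empty, since on the
    empty set everything converges. *)
Lemma rosenthal_independent V M : unbounded M -> oscillates V M ->
  exists j : nat -> nat, [/\ forall m n, (m < n)%N -> (j m < j n)%N,
    forall n, M (j n) &
    forall n s, size s = n -> word V (history j n) s !=set0].
Proof.
move=> iM oV.
pose Q h M' := forall W, W \in words V h -> oscillates W M'.
have [||j [jlt jM jQ]] := fusion (Q := Q) iM.
- by move=> W; rewrite inE => /eqP ->.
- move=> h M1 iM1 QM1.
  have [M2 sM2 [iM2 h2]] := oscillates_split iM1 QM1.
  have [j _ M2j] := iM2 0%N; exists j, (M2 `&` [set k | (j < k)%N]); split.
  + exact: sM2.
  + exact: unbounded_gt.
  + by move=> k [/sM2].
  + move=> W; rewrite mem_cat => WL.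
    apply: (@oscillates_sub _ M2); first by move=> k [].
    by case/orP: WL => /mapP[W' W'L ->]; apply: h2.
exists j; split=> // n s szs; apply: contrapT => emp.
have [M1 + M1j] := jQ n => /(_ (word V (history j n) s)).
rewrite mem_words ?size_history// => /(_ isT M1) oW.
have jge := increasing_ge_id jlt.
apply: oW => [|m|f Wf]; [by [] | | by case: emp; exists f].
exists (j (maxn m n)); last by apply: M1j; lia.
by apply: leq_trans (jge _); lia.
Qed.

Lemma word_history_nseq V (j : nat -> nat) n m s b f : size s = n ->
  word V (history j (m + n)) (nseq m b ++ s) f ->
  forall i, (n <= i < m + n)%N -> E b (j i) f.
Proof.
move=> szs; elim: m => [_ i|m IH]; first by lia.
rewrite addSn historyS /= => -[/IH{}IH Ef] i.
have [->//|ne /andP[lei lti]] := eqVneq i (m + n)%N.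
by apply: IH; lia.
Qed.

Lemma word_history_cat V (j : nat -> nat) t s :
  word V (history j (size (t ++ s))) (t ++ s) `<=` word V (history j (size s)) s.
Proof. by elim: t => //= b t IH; rewrite historyS => f [/IH]. Qed.

End Rosenthal.

(** * Functionals and weak* cluster points *)

Lemma ultra_cvg (R : realType) (U : set_system nat) (a : nat -> R) (C : R) :
  UltraFilter U -> (forall n, `|a n| <= C) -> cvg (a @ U).
Proof.
move=> UU aC.
have [|p [_ clp]] := @segment_compact R (- C) C (a @ U) _.
  by apply: (@filterE _ U) => n /=; rewrite in_itv /= -ler_norml.
apply/cvg_ex; exists p => B nB.
have [//|UnB] := in_ultra_setVsetC (a @^-1` B) UU.
by have [? [nBx Bx]] := clp (~` B) B UnB nB.
Qed.

(** Limits along this free ultrafilter replace weak* compactness, both in the dual ball and in the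
    bidual. *)
Lemma ultrafilter_infty : exists2 U : set_system nat, UltraFilter U &
  forall N, U [set n | (N <= n)%N].
Proof.
have [U [UU sU]] := @ultraFilterLemma nat \oo _.
by exists U => // N; apply: sU; exists N.
Qed.

Section Dual.
Context {R : realType} {X : normedModType R}.
Implicit Types (f g : X -> R) (Phi Psi : (X -> R) -> R) (u w : nat -> X).

Lemma dual0 f : dual f -> f 0 = 0.
Proof. by case=> lin _; have := lin 1 0 0; rewrite scaler0 addr0; lra. Qed.

Lemma dualZ f a x : dual f -> f (a *: x) = a * f x.
Proof. by move=> df; have [/(_ a x 0) + _] := df; rewrite addr0 dual0// addr0. Qed.

Lemma dualD f x y : dual f -> f (x + y) = f x + f y.
Proof. by case=> /(_ 1 x y); rewrite scale1r mul1r. Qed.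

Lemma dualN f x : dual f -> f (- x) = - f x.
Proof. by move=> df; rewrite -scaleN1r dualZ// mulN1r. Qed.

Lemma dual_ballP f : (forall (a : R) (x y : X), f (a *: x + y) = a * f x + f y) ->
  (forall x, `|f x| <= `|x|) -> dual_ball f.
Proof.
move=> lin fx; split=> //; split=> // x.
apply/cvgrPdist_lt => e e0; near=> y.
have -> : f x - f y = f (x - y).
  by rewrite (addrC x) -(scaleN1r y) lin; ring.
by apply: le_lt_trans (fx _) _; near: y; apply: cvgr_dist_lt.
Unshelve. all: by end_near. Qed.

Lemma dual_ball_combination f g t : 0 <= t <= 1 -> dual_ball f -> dual_ball g ->
  dual_ball (fun x => t * f x + (1 - t) * g x).
Proof.
move=> /andP[t0 t1] [[fl _] fb] [[gl _] gb]; apply: dual_ballP => [a x y|x].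
  by rewrite fl gl; ring.
apply: le_trans (ler_normD _ _) _.
rewrite !normrM (ger0_norm t0) (@ger0_norm _ (1 - t)) ?subr_ge0//.
by have := fb x; have := gb x; nra.
Qed.

Lemma dual_ballN f : dual_ball f -> dual_ball (fun x => - f x).
Proof.
move=> [[fl _] fb]; apply: dual_ballP => [a x y|x]; first by rewrite fl; ring.
by rewrite normrN.
Qed.

Lemma dual_ball0 : dual_ball (fun _ : X => 0 : R).
Proof. by apply: dual_ballP => [a x y|x]; [ring|rewrite normr0]. Qed.

Lemma dual_bounded f r : dual f -> exists C, forall x, `|x| <= r -> `|f x| <= C.
Proof.
move=> [lin cf].
pose fL : {linear X -> R^o} :=
  HB.pack f (GRing.isLinear.Build R X R^o *:%R f lin).
have [_ bd] := bounded_funP fL; apply: bd.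
by apply: continuous_linear_bounded; apply: cf.
Qed.

(** The pointwise limit along a free ultrafilter. Upper bounds are obtained from lower ones at
    [- x]. *)
Lemma dual_ball_limit (F : nat -> X -> R) : (forall m, dual_ball (F m)) ->
  exists2 f, dual_ball f & forall x (a : R),
    (exists N, forall m, (N <= m)%N -> a <= F m x) -> a <= f x.
Proof.
move=> FB; have [U UU Uoo] := ultrafilter_infty.
have cF x : cvg (F ^~ x @ U) by apply: (ultra_cvg UU) => m; have [_] := FB m; apply.
exists (fun x => lim (F ^~ x @ U)).
  apply: dual_ballP => [a x y|x].
    apply: cvg_lim => //.
    rewrite (_ : F ^~ _ = (fun m => a * F m x + F m y)); last first.
      by apply/funext => m; have [[-> _] _] := FB m.
    by apply: cvgD; [apply: cvgMl_tmp|]; apply: cF.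
  rewrite ler_norml; apply/andP; split.
    apply: limr_ge => //; apply: nearW => m; have [_ /(_ x)] := FB m.
    by rewrite ler_norml => /andP[].
  apply: limr_le => //; apply: nearW => m; have [_ /(_ x)] := FB m.
  by rewrite ler_norml => /andP[].
move=> x a [N aF]; apply: limr_ge => //.
by apply: filterS (Uoo N) => m; apply: aF.
Qed.

(** The limit of [f (w k)] along a free ultrafilter, as a function of [f], is a cluster point.
    Outside the dual this limit may be a default value, which [bidual] ignores. *)
Lemma clust_nonempty w (C : R) : (forall k, `|w k| <= C) -> clust w !=set0.
Proof.
move=> wC; have [U UU Uoo] := ultrafilter_infty.
have cw f : dual f -> cvg (f (w k) @[k --> U]).
  by move=> df; have [D fD] := dual_bounded C df; apply: (ultra_cvg UU) => k; apply: fD.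
exists (fun f => lim (f (w k) @[k --> U])); split; first split.
- move=> a f g df dg; apply: cvg_lim => //.
  by apply: cvgD; [apply: cvgMl_tmp|]; apply: cw.
- exists C => f [df fb]; have fC k : `|f (w k)| <= C by apply: le_trans (wC k).
  rewrite ler_norml; apply/andP; split.
    apply: limr_ge; first exact: cw.
    by apply: nearW => k; have := fC k; rewrite ler_norml => /andP[].
  apply: limr_le; first exact: cw.
  by apply: nearW => k; have := fC k; rewrite ler_norml => /andP[].
- move=> n F e dF e0 N.
  have Ue : \forall k \near U, forall i, `|F i (w k) - lim (F i (w k) @[k --> U])| < e.
    apply: filter_forall => i; have /cvgrPdist_lt/(_ e e0) := cw _ (dF i).
    by apply: filterS => k; rewrite distrC.
  have [k [ek Nk]] := filter_ex (filterI Ue (Uoo N)).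
  by exists k; split.
Qed.

Lemma clust_near w Phi f (e : R) N : clust w Phi -> dual f -> 0 < e ->
  exists2 k, (N <= k)%N & `|f (w k) - Phi f| < e.
Proof.
move=> [_ cl] df e0.
by have [k [Nk /(_ ord0)]] := cl 1%N (fun _ => f) e (fun _ => df) e0 N; exists k.
Qed.

Lemma clust_ge w Phi f (a : R) N : clust w Phi -> dual f ->
  (forall k, (N <= k)%N -> a <= f (w k)) -> a <= Phi f.
Proof.
move=> cl df af; apply/ler_addgt0Pr => e e0.
have [k /af ak] := clust_near N cl df e0; rewrite ltr_distl => /andP[h1 h2].
by apply: le_trans ak _; lra.
Qed.

Lemma clust_le w Phi f (a : R) N : clust w Phi -> dual f ->
  (forall k, (N <= k)%N -> f (w k) <= a) -> Phi f <= a.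
Proof.
move=> cl df af; apply/ler_addgt0Pr => e e0.
have [k /af ak] := clust_near N cl df e0; rewrite ltr_distl => /andP[h1 h2].
lra.
Qed.

Lemma clust_subseq u (j : nat -> nat) :
  (forall m n, (m < n)%N -> (j m < j n)%N) -> clust (u \o j) `<=` clust u.
Proof.
move=> jlt Phi [bP cl]; split=> // n F e dF e0 N.
have [k [Nk kP]] := cl n F e dF e0 N; exists (j k); split=> //.
exact: leq_trans (increasing_ge_id jlt k).
Qed.

Lemma bnorm_ge Phi f : dual_ball f -> (`|Phi f|%:E <= bnorm Phi)%E.
Proof. by move=> fB; apply: ereal_sup_ubound; exists f. Qed.

Lemma bnorm_le Phi (M : \bar R) : (forall f, dual_ball f -> (`|Phi f|%:E <= M)%E) ->
  (bnorm Phi <= M)%E.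
Proof. by move=> PM; apply: ge_ereal_sup => _ [f fB <-]; apply: PM. Qed.

Lemma bnorm_ge0 Phi : (0 <= bnorm Phi)%E.
Proof. by apply: le_trans (bnorm_ge Phi dual_ball0); rewrite lee_fin. Qed.

End Dual.

(** * The upper bound for the oscillation of subsequences *)

Section Subsequence.
Context {R : realType} {X : normedModType R}.
Implicit Types (f g : X -> R) (Phi Psi : (X -> R) -> R) (u w : nat -> X).

Definition level u (p q : R) (b : bool) (k : nat) : set (X -> R) :=
  if b then [set f | q < f (u k)] else [set f | f (u k) < p].

(* Words are coloured by the values at x, up to e, of the functionals following
   them. By [colour_extension] some functionals follow the same word, then only
   the letter true, resp. only false, and nearly agree at x. *)
Lemma independent_clust_far u (p q : R) (j : nat -> nat) Phi x :
  (forall n s, size s = n -> word (level u p q) dual_ball (history j n) s !=set0) ->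
  clust (u \o j) Phi -> (((q - p) / 2)%:E <= bnorm (bsub Phi (embed x)))%E.
Proof.
move=> ind cl; apply/lee_addgt0Pr => e e0.
pose W s := word (level u p q) dual_ball (history j (size s)) s.
(* The shift by |x| puts the value into [0, 2|x|], so that finitely many cells of length [e]
   suffice. *)
pose col s (c : nat) := exists2 f, W s f & c%:R * e <= f x + `|x| <= c.+1%:R * e.
have [||s [c cP]] := @colour_extension (Num.truncn (2 * `|x| / e)).+1 col.
- by move=> t s c [f Wf cf]; exists f => //; apply: word_history_cat Wf.
- move=> s; have [f Wf] := ind (size s) s erefl.
  have := (wordW Wf).2 x; rewrite ler_norml => /andP[fx1 fx2].
  have ge0 : 0 <= (f x + `|x|) / e by apply: divr_ge0; lra.
  exists (Num.truncn ((f x + `|x|) / e)).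
    rewrite ltnS; apply: le_truncn; rewrite ler_pM2r ?invr_gt0//; lra.
  exists f => //; have /andP[h1 h2] := truncn_itv ge0.
  by rewrite -ler_pdivlMr// h1 -ler_pdivrMr// ltW.
(* A limit of functionals that follow [s] and then ever more letters [b] satisfies the weak
   inequality of level [b] at all [j i] with [size s <= i], and this passes to [Phi]. *)
have lim b : exists f, [/\ dual_ball f, c%:R * e <= f x + `|x| <= c.+1%:R * e
    & if b then q <= Phi f else Phi f <= p].
  have /choice[F FP] m : exists f, W (nseq m b ++ s) f /\
      c%:R * e <= f x + `|x| <= c.+1%:R * e.
    by have [f] := cP (nseq m b); exists f.
  have FB m : dual_ball (F m) by have [Wm _] := FP m; apply: wordW Wm.
  have [f fB fP] := dual_ball_limit FB.
  have fj i m : (size s <= i)%N -> (i < m)%N -> level u p q b (j i) (F m).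
    move=> lei lim; have [] := FP m; rewrite /W size_cat size_nseq => Wm _.
    by apply: (word_history_nseq erefl Wm); lia.
  have df := fB.1; exists f; split=> //.
    apply/andP; split.
      rewrite -lerBlDr; apply: fP; exists 0%N => m _.
      by rewrite lerBlDr; have [_ /andP[]] := FP m.
    rewrite -lerBrDr -lerN2 -(dualN _ df); apply: fP; exists 0%N => m _.
    by rewrite (dualN _ (FB m).1) lerN2 lerBrDr; have [_ /andP[]] := FP m.
  case: b {FP} fj => fj.
    apply: (clust_ge (N := size s) cl df) => i lei; apply: fP; exists i.+1 => m lti.
    by apply: ltW; apply: (fj i).
  apply: (clust_le (N := size s) cl df) => i lei; rewrite -lerN2 -(dualN _ df).
  apply: fP; exists i.+1 => m lti.
  by rewrite (dualN _ (FB m).1) lerN2; apply: ltW; apply: (fj i).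
have [[f [fB /andP[f1 f2] qf]] [g [gB /andP[g1 g2] gp]]] := (lim true, lim false).
(* As [f x] and [g x] lie in one cell, the values of Phi - x at [f] and [g] differ by at least q - p
   - e, so one of them is large. *)
have osc : (q - p) - e <= `|Phi f - f x| + `|Phi g - g x|.
  rewrite -natr1 in f2 g2.
  have := ler_norm (Phi f - f x); have := ler_norm (- (Phi g - g x)); rewrite normrN.
  nra.
have [h hB hP] : exists2 h, dual_ball h & (q - p) / 2 - e <= `|bsub Phi (embed x) h|.
  have [le|lt] := lerP ((q - p) / 2 - e) `|Phi f - f x|; first by exists f.
  by exists g => //; rewrite /bsub /embed; lra.
apply: (@le_trans _ _ (`|bsub Phi (embed x) h|%:E + e%:E)%E).
  by rewrite -EFinD lee_fin -lerBlDr.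
by rewrite leeD2r// bnorm_ge.
Qed.

(** If two cluster points differed by more than 2c at [f], rationals [q] just below the larger value
    and [p] just above the smaller one would still satisfy q - p >= 2c, and [f] would be above [q]
    and below [p] infinitely often. *)
Lemma converging_subseq u (c : R) (j : nat -> nat) :
  (forall m n, (m < n)%N -> (j m < j n)%N) ->
  (forall p q : rat, 2 * c <= ratr q - ratr p -> exists N M,
     converges (level u (ratr p) (ratr q)) dual_ball M /\
     forall m, (N <= m)%N -> M (j m)) ->
  (deltaX (u \o j) <= (2 * c)%:E)%E.
Proof.
move=> jlt cv; apply: ge_ereal_sup => _ [Phi [Psi [cPhi [cPsi ->]]]].
have key Phi1 Phi2 f : clust (u \o j) Phi1 -> clust (u \o j) Phi2 -> dual_ball f ->
    Phi1 f - Phi2 f <= 2 * c.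
  move=> c1 c2 fB; rewrite leNgt; apply/negP => lt.
  pose d := (Phi1 f - Phi2 f - 2 * c) / 2.
  have d0 : 0 < d by rewrite /d; lra.
  have [q /= +] := @rat_in_itvoo _ (Phi1 f - d) (Phi1 f) ltac:(lra).
  have [p /= +] := @rat_in_itvoo _ (Phi2 f) (Phi2 f + d) ltac:(lra).
  rewrite !in_itv /= => /andP[p1 p2] /andP[q1 q2].
  have [|N [M [/(_ f fB) [b nb] MN]]] := cv p q; first by rewrite /d in p2 q1; lra.
  apply: nb => n.
  have ge k : (maxn n N <= k)%N -> (n <= j k)%N /\ M (j k).
    by move=> lek; split; [have := increasing_ge_id jlt k; lia|apply: MN; lia].
  case: b.
    have q0 : 0 < Phi1 f - ratr q by lra.
    have [k /ge[? ?]] := clust_near (maxn n N) c1 fB.1 q0.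
    rewrite ltr_distl => /andP[h1 h2].
    by exists (j k) => //; split=> //=; rewrite /level; move: h1 => /=; lra.
  have p0 : 0 < ratr p - Phi2 f by lra.
  have [k /ge[? ?]] := clust_near (maxn n N) c2 fB.1 p0.
  rewrite ltr_distl => /andP[h1 h2].
  by exists (j k) => //; split=> //=; rewrite /level; move: h2 => /=; lra.
apply: bnorm_le => f fB; rewrite lee_fin /bsub ler_norml lerNl opprB.
by rewrite !key.
Qed.

Lemma small_oscillation_subseq u (C c : R) : (forall k, `|u k| <= C) ->
  (forall Phi, clust u Phi -> exists x, (bnorm (bsub Phi (embed x)) < c%:E)%E) ->
  (delta_tilde u <= (2 * c)%:E)%E.
Proof.
move=> uC near.
(* Otherwise an independent subsequence exists, and all its cluster points have distance at least
   [c] from every [x], against [near]. *)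
have conv (p q : rat) M : 2 * c <= ratr q - ratr p -> unbounded M ->
    exists M', [/\ M' `<=` M, unbounded M' &
      converges (level u (ratr p) (ratr q)) dual_ball M'].
  move=> pq iM; apply: contrapT => nM.
  have [|j [jlt _ ind]] := @rosenthal_independent _ (level u (ratr p) (ratr q)) dual_ball M iM.
    by move=> M' sM' iM' cM'; apply: nM; exists M'.
  have [Phi cl] := @clust_nonempty _ _ (u \o j) C (fun k => uC (j k)).
  have [x] := near Phi (clust_subseq jlt cl).
  rewrite ltNge (le_trans _ (independent_clust_far x ind cl))// lee_fin; lra.
(* Diagonal argument over the pairs of rationals: the pair with code n is treated when the history
   reaches length n + 1. The empty history is exempt, because [(size h).-1] is 0 for it too. *)
pose Q (h : seq nat) M := forall pq : rat * rat, pickle pq = (size h).-1 ->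
  2 * c <= ratr pq.2 - ratr pq.1 -> h = [::] \/
  converges (level u (ratr pq.1) (ratr pq.2)) dual_ball M.
have [|||j [jlt _ jQ]] := fusion (Q := Q) (M0 := setT).
- by move=> N; exists N.
- by move=> pq _ _; left.
- move=> h M iM _.
  have [M' [sM' iM' cM']] : exists M', [/\ M' `<=` M, unbounded M' &
      forall pq : rat * rat, pickle pq = size h -> 2 * c <= ratr pq.2 - ratr pq.1 ->
        converges (level u (ratr pq.1) (ratr pq.2)) dual_ball M'].
    have [[pq [eh le]]|no] := pselect (exists pq : rat * rat,
      pickle pq = size h /\ 2 * c <= ratr pq.2 - ratr pq.1 :> R).
      have [M' [sM' iM' cM']] := conv _ _ _ le iM; exists M'; split=> // pq' eh'.
      by have -> : pq' = pq by apply: (pcan_inj pickleK); rewrite eh'.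
    by exists M; split=> // pq eh le; case: no; exists pq.
  have [k _ M'k] := iM' 0%N; exists k, (M' `&` [set i | (k < i)%N]); split.
  + exact: sM'.
  + exact: unbounded_gt.
  + by move=> i [/sM'].
  + move=> pq eh le; right.
    by apply: (@converges_tail _ _ _ M' _ 0) (cM' pq eh le) => i _ [].
apply: (@le_trans _ _ (deltaX (u \o j))).
  by apply: ereal_inf_lbound; exists j.
apply: converging_subseq => // p q le.
have [M QM Mj] := jQ (pickle (p, q)).+1; exists (pickle (p, q)).+1, M; split=> //.
by have [] := QM (p, q); rewrite ?size_history// historyS.
Qed.

Lemma dist_X_ge0 Phi : (0 <= dist_X Phi)%E.
Proof. by apply: le_ereal_inf_tmp => _ [x _ <-]; apply: bnorm_ge0. Qed.

Lemma dist_X_le_dhat A Phi : A Phi -> (dist_X Phi <= dhat_X A)%E.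
Proof. by move=> APhi; apply: ereal_sup_ubound; exists Phi. Qed.

Lemma delta_tilde_le_dhat u (C : R) : (forall k, `|u k| <= C) ->
  (delta_tilde u <= 2%:E * dhat_X (clust u))%E.
Proof.
move=> uC; have [Phi0 cl0] := clust_nonempty uC.
(* Nonnegativity excludes the value -oo. *)
have := le_trans (dist_X_ge0 Phi0) (dist_X_le_dhat cl0).
case E : (dhat_X (clust u)) => [d| |]; last first.
- by rewrite leeNy_eq.
- by move=> _; rewrite gt0_muley ?lte_fin// leey.
rewrite lee_fin => d0; apply/lee_addgt0Pr => e e0.
rewrite -EFinM -EFinD (_ : 2 * d + e = 2 * (d + e / 2)); last by field.
apply: (small_oscillation_subseq uC) => Phi cl.
have /ereal_inf_lt[_ [x _ <-] lt] : (dist_X Phi < (d + e / 2)%:E)%E.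
  by apply: le_lt_trans (dist_X_le_dhat cl) _; rewrite E lte_fin; lra.
by exists x.
Qed.

End Subsequence.

(** * L-embedded spaces *)

(** Step length [t] and tolerance [eta] for a descent whose linear gain t d must beat the quadratic
    error t^2 K. With L >= K and L >= d, the choice t = d / (2L) bounds this error by t d / 2, and
    eta = t d / 4 fits in the rest. *)
Lemma quadratic_step (R : realFieldType) (d K : R) : 0 < d ->
  exists t eta : R, [/\ 0 <= t <= 1, 0 < eta & t ^+ 2 * K + eta < t * d].
Proof.
move=> d0; pose L := `|K| + d.
have L0 : 0 < L by rewrite /L; have := normr_ge0 K; lra.
have KL : K <= L by rewrite /L; have := ler_norm K; lra.
have dL : d <= L by rewrite /L; have := normr_ge0 K; lra.
have t0 : 0 < d / (2 * L) by rewrite divr_gt0//; lra.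
have tL : d / (2 * L) * L = d / 2 by field; rewrite gt_eqF.
exists (d / (2 * L)), (d / (2 * L) * d / 4); set t := d / (2 * L) in t0 tL *.
split; first by nra.
- by nra.
- have : t ^+ 2 * K <= t * (t * L) by nra.
  by rewrite tL; nra.
Qed.

(* If z were at distance > 0 from the image of C, then moving from an almost
   nearest point g0 towards a maximiser over C of the functional
   sum_i (z_i - L_i g0) L_i would come strictly closer to z. *)
Lemma convex_image_dense (R : realType) (I : eqType) (V : Type) (C : set V)
    (s : seq I) (L : I -> V -> R) (z : I -> R) :
  (forall g h t, C g -> C h -> 0 <= t <= 1 ->
     exists2 k, C k & forall i, L i k = t * L i g + (1 - t) * L i h) ->
  (exists K, forall g h, C g -> C h -> \sum_(i <- s) (L i g - L i h) ^+ 2 <= K) ->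
  (forall (a : I -> R) e, 0 < e -> exists2 g, C g &
     \sum_(i <- s) a i * z i <= \sum_(i <- s) a i * L i g + e) ->
  forall e, 0 < e -> exists2 g, C g & forall i, i \in s -> `|L i g - z i| < e.
Proof.
move=> conv [K bdd] dom e e0.
pose dist g := \sum_(i <- s) (z i - L i g) ^+ 2.
have [[g Cg dg]|far] := pselect (exists2 g, C g & dist g < e ^+ 2).
  exists g => // i si; rewrite distrC -(ltr_pXn2r (n := 2)) ?nnegrE ?normr_ge0 ?(ltW e0)//.
  apply: le_lt_trans dg; rewrite -normrX ger0_norm ?sqr_ge0//.
  by rewrite /dist (big_rem i)//= lerDl sumr_ge0// => k _; rewrite sqr_ge0.
exfalso.
pose D := [set dist g | g in C].
have D0 : D !=set0.
  have [g0 Cg0 _] := dom (fun=> 0) 1 ltr01; by exists (dist g0), g0.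
have Dlb : lbound D (e ^+ 2).
  by move=> _ [g0 Cg0 <-]; rewrite leNgt; apply/negP => lt; apply: far; exists g0.
have hD : has_inf D by split=> //; exists (e ^+ 2).
have d0 : 0 < inf D.
  by apply: lt_le_trans (lb_le_inf D0 Dlb); rewrite exprn_gt0.
have [t [eta [t01 eta0 step]]] := quadratic_step K d0.
have [_ [g0 Cg0 <-] g0d] := inf_adherent eta0 hD.
have [g Cg domg] := dom (fun i => z i - L i g0) (inf D / 2) ltac:(lra).
have [k Ck Lk] := conv g g0 t Cg Cg0 t01.
have distk : dist k = dist g0
    - 2 * t * (\sum_(i <- s) (z i - L i g0) * (L i g - L i g0))
    + t ^+ 2 * \sum_(i <- s) (L i g - L i g0) ^+ 2.
  rewrite /dist !mulr_sumr -sumrN -!big_split /=.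
  by apply: eq_bigr => i _; rewrite Lk; ring.
(* Hence the inner product is at least inf D / 2, and the linear term in [distk] gains at least t
   inf D, more than [eta] and the quadratic term together. *)
have inner : dist g0 <= \sum_(i <- s) (z i - L i g0) * (L i g - L i g0) + inf D / 2.
  suff : \sum_(i <- s) (z i - L i g0) * z i - \sum_(i <- s) (z i - L i g0) * L i g =
      dist g0 - \sum_(i <- s) (z i - L i g0) * (L i g - L i g0) by lra.
  by rewrite /dist -!sumrB; apply: eq_bigr => i _; ring.
have lek : inf D <= dist k by apply: ge_inf; [exists (e ^+ 2)|exists k].
have le0 : inf D <= dist g0 by apply: ge_inf; [exists (e ^+ 2)|exists g0].
have := bdd g g0 Cg Cg0.
set S1 := (X in dist g0 <= X + _) in inner; set S2 := \sum_(i <- s) _ => leK.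
rewrite -/S1 -/S2 in distk.
case/andP: t01 => t0 t1.
have : t ^+ 2 * S2 <= t ^+ 2 * K by apply: ler_wpM2l => //; apply: sqr_ge0.
have : t * (inf D / 2) <= t * S1 by apply: ler_wpM2l => //; lra.
lra.
Qed.

Section LEmbedded.
Context {R : realType} {X : normedModType R}.
Implicit Types (f g : X -> R) (Phi Psi : (X -> R) -> R) (u w : nat -> X).

Lemma bidual_embed (x : X) : bidual (embed x).
Proof.
split=> [a f g _ _|] //.
by exists `|x| => f [_]; apply.
Qed.

Lemma dual_combination (a : R) f g : dual f -> dual g ->
  dual (fun x => a * f x + g x).
Proof.
move=> [lf cf] [lg cg]; split=> [b x y|x]; first by rewrite lf lg; ring.
by apply: cvgD; [apply: cvgMl_tmp; apply: cf|apply: cg].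
Qed.

Lemma dual_sum (I : Type) (s : seq I) (a : I -> R) (F : I -> X) f : dual f ->
  f (\sum_(i <- s) a i *: F i) = \sum_(i <- s) a i * f (F i).
Proof.
move=> df; elim: s => [|i s IH]; first by rewrite !big_nil dual0.
by rewrite !big_cons dualD// dualZ// IH.
Qed.

Lemma bidual_combination (a : R) Phi Psi : bidual Phi -> bidual Psi ->
  bidual (fun f => a * Phi f + Psi f).
Proof.
move=> [lP [C bP]] [lQ [D bQ]]; split=> [c f g df dg|].
  by rewrite lP// lQ//; ring.
exists (`|a| * C + D) => f fB; apply: le_trans (ler_normD _ _) _.
by rewrite !normrM lerD ?bQ// ler_wpM2l// bP.
Qed.

Lemma bidual0 Phi : bidual Phi -> Phi (fun=> 0) = 0.
Proof.
move=> [lin _]; have d0 := (@dual_ball0 R X).1.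
by have := lin 1 _ _ d0 d0; under eq_fun do rewrite mulr0 addr0; lra.
Qed.

Lemma bidualZ Phi (a : R) f : bidual Phi -> dual f ->
  Phi (fun x => a * f x) = a * Phi f.
Proof.
move=> bPhi df; have := bPhi.1 a _ _ df (@dual_ball0 R X).1.
by under eq_fun do rewrite addr0; rewrite bidual0// addr0.
Qed.

Lemma bidualD Phi (a b : R) f g : bidual Phi -> dual f -> dual g ->
  Phi (fun x => a * f x + b * g x) = a * Phi f + b * Phi g.
Proof.
move=> bPhi df dg; have := dual_combination b dg (@dual_ball0 R X).1.
under eq_fun do rewrite addr0; move=> dbg.
by rewrite bPhi.1// bidualZ.
Qed.

Lemma bnorm_approached Phi (r e : R) : bidual Phi -> 0 < e -> (r%:E <= bnorm Phi)%E ->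
  exists2 f, dual_ball f & r <= Phi f + e.
Proof.
move=> bPhi e0 rP.
have : ((r - e)%:E < bnorm Phi)%E by apply: lt_le_trans rP; rewrite lte_fin; lra.
move=> /ereal_sup_gt[_ [f fB <-]]; rewrite lte_fin => lt.
have [p|n] := lerP 0 (Phi f); first by exists f => //; move: lt; rewrite ger0_norm//; lra.
exists (fun x => - f x); first exact: dual_ballN.
have := bidualZ (- 1) bPhi fB.1; under eq_fun do rewrite mulN1r.
by move=> ->; move: lt; rewrite ltr0_norm//; lra.
Qed.

(* The L-decomposition makes f on span es, extended by the value theta |Psi g1|
   at Psi, a functional of norm at most 1; this is Helly's theorem for it. *)
Lemma L_embedded_extension (es : seq X) Psi f g1 (theta e : R) :
  bidual Psi -> dual_ball f -> dual_ball g1 -> `|theta| <= 1 ->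
  (forall (y : X) (a : R), bnorm (fun h => a * Psi h + h y) =
     (bnorm (embed y) + bnorm (fun h => (a * Psi h)%R))%E) ->
  0 < e -> exists g, [/\ dual_ball g, `|Psi g - theta * `|Psi g1| | < e &
    forall x, x \in es -> `|g x - f x| < e].
Proof.
move=> bPsi fB g1B th ladd e0.
(* [None] stands for evaluation at [Psi], [Some x] for evaluation at [x]. *)
pose L (i : option X) h := if i is Some x then h x else Psi h.
pose z i := if i is Some x then f x else theta * `|Psi g1|.
have [_ [C PsiC]] := bPsi.
have [|||g gB gz] := @convex_image_dense R (option X) (X -> R) dual_ball
    (None :: map Some es) L z _ _ _ e e0.
- move=> g h t gB hB t01.
  exists (fun x => t * g x + (1 - t) * h x); first exact: dual_ball_combination.
  by case=> //; rewrite /L bidualD//; [apply: gB.1|apply: hB.1].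
- pose D (i : option X) := if i is Some x then `|x| else C.
  have LD i h : dual_ball h -> `|L i h| <= D i.
    by move=> hB; case: i => [x|]; [apply: hB.2|apply: PsiC].
  exists (\sum_(i <- None :: map Some es) (2 * D i) ^+ 2) => g h gB hB.
  apply: ler_sum => i _; have := LD i g gB; have := LD i h hB.
  by rewrite !ler_norml => /andP[? ?] /andP[? ?]; nra.
- move=> a eta eta0.
  pose y := \sum_(x <- es) a (Some x) *: x.
  have sumE h (r : option X -> R) : dual h -> (forall x, r (Some x) = h x) ->
      \sum_(i <- None :: map Some es) a i * r i = a None * r None + h y.
    move=> dh rE; rewrite big_cons big_map dual_sum//; congr (_ + _).
    by apply: eq_bigr => x _; rewrite rE.
  have bLam : bidual (fun h => a None * Psi h + h y).
    exact: bidual_combination bPsi (bidual_embed y).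
  (* Helly's condition: the prescribed value of a Psi + y is at most |a Psi| + |y|, which by [ladd]
     is the norm of a Psi + y and is nearly attained on the ball. *)
  have [|h hB hP] := @bnorm_approached _ (a None * (theta * `|Psi g1|) + f y) eta bLam eta0.
    rewrite ladd addeC.
    apply: (@le_trans _ _ (`|(a None * Psi g1)%R|%:E + `|f y|%:E)%E); last first.
      by apply: leeD; apply: (bnorm_ge _ _).
    rewrite -EFinD lee_fin lerD ?ler_norm//.
    rewrite (le_trans (ler_norm _))// !normrM normr_id ler_wpM2l//.
    by rewrite ler_piMl.
  exists h => //.
  by rewrite (sumE f)//; [rewrite (sumE h)//; apply: hB.1|apply: fB.1].
exists g; split=> //; first by apply: (gz None); rewrite mem_head.
by move=> x xes; apply: (gz (Some x)); rewrite in_cons map_f ?orbT.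
Qed.

(** [P] kills [Psi], so it maps a Psi + y to y, and the norm formula at a Psi + y is the claim. *)
Lemma L_embedded_complement (P : ((X -> R) -> R) -> X) Phi :
  (forall (a : R) Phi Psi, bidual Phi -> bidual Psi ->
     P (fun f => a * Phi f + Psi f) = a *: P Phi + P Psi) ->
  (forall x : X, P (embed x) = x) ->
  (forall Phi, bidual Phi ->
     bnorm Phi = (bnorm (embed (P Phi)) + bnorm (bsub Phi (embed (P Phi))))%E) ->
  bidual Phi -> let Psi := bsub Phi (embed (P Phi)) in
  bidual Psi /\ forall (y : X) (a : R), bnorm (fun h => a * Psi h + h y) =
    (bnorm (embed y) + bnorm (fun h => (a * Psi h)%R))%E.
Proof.
move=> Plin Pid Padd bPhi Psi.
have PsiE : Psi = fun f => - 1 * embed (P Phi) f + Phi f.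
  by apply/funext => f; rewrite /Psi /bsub; ring.
have bPsi : bidual Psi.
  by rewrite PsiE; apply: bidual_combination => //; apply: bidual_embed.
split=> // y a.
have PPsi : P Psi = 0.
  by rewrite PsiE Plin//; [rewrite Pid scaleN1r addNr|apply: bidual_embed].
have bLam : bidual (fun h => a * Psi h + h y).
  exact: bidual_combination bPsi (bidual_embed y).
have PLam : P (fun h => a * Psi h + h y) = y.
  by rewrite (Plin _ _ (embed y))// ?PPsi ?scaler0 ?add0r//; apply: bidual_embed.
rewrite Padd// PLam; congr (_ + bnorm _)%E.
by apply/funext => h; rewrite /bsub /embed; ring.
Qed.

(** With the newest index first, [size h'] is the rank of [k] in the order of choice. Strictness
    leaves room to perturb [f]. *)
Fixpoint alternates u (x : X) (r : R) (h : seq nat) f : Prop :=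
  if h is k :: h' then
    r < (-1) ^+ size h' * (f (u k) - f x) /\ alternates u x r h' f
  else True.

Lemma alternates_open u x (r : R) h f : alternates u x r h f ->
  exists2 e : R, 0 < e & forall g,
    (forall y, y \in x :: map u h -> `|g y - f y| < e) -> alternates u x r h g.
Proof.
elim: h => [_|k h IH [rk /IH[e e0 eP]]]; first by exists 1.
(* Half the margin, since the values at [u k] and at [x] may both move. *)
pose d := ((-1) ^+ size h * (f (u k) - f x) - r) / 2.
have d0 : 0 < d by rewrite /d; lra.
exists (Num.min e d) => [|g gf]; first by rewrite lt_min e0 d0.
split; last first.
  apply: eP => y yh; have : `|g y - f y| < Num.min e d.
    by apply: gf; move: yh; rewrite !in_cons => /orP[->//|->]; rewrite !orbT.
  by rewrite lt_min => /andP[].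
have : `|g x - f x| < Num.min e d by apply: gf; rewrite mem_head.
have : `|g (u k) - f (u k)| < Num.min e d by apply: gf; rewrite !in_cons eqxx orbT.
rewrite !lt_min !ltr_norml => /andP[_ /andP[h1 h2]] /andP[_ /andP[h3 h4]].
move: h1 h2 h3 h4; rewrite /d -signr_odd.
by case: odd; rewrite ?expr1 ?expr0; lra.
Qed.

Lemma alternates_history u x (r : R) (j : nat -> nat) n f :
  alternates u x r (history j n) f ->
  forall i, (i < n)%N -> r < (-1) ^+ i * (f (u (j i)) - f x).
Proof.
elim: n => // n IH; rewrite historyS /= size_history => -[rn /IH{}IH] i.
by rewrite ltnS leq_eqVlt => /predU1P[->|/IH].
Qed.

(** Each step moves the value at [Psi] to within eta/2 of plus or minus |Psi g1|, nearly fixing the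
    values used so far, then picks [k] with [g' (u k)] within eta/2 of Phi g' = g' x + Psi g'. A
    pointwise limit of these functionals is [f]. *)
Lemma L_embedded_alternating u Phi x g1 (eta : R) : let Psi := bsub Phi (embed x) in
  clust u Phi -> bidual Psi ->
  (forall (y : X) (a : R), bnorm (fun h => a * Psi h + h y) =
    (bnorm (embed y) + bnorm (fun h => (a * Psi h)%R))%E) ->
  dual_ball g1 -> 0 < eta ->
  exists (j : nat -> nat) f, [/\ forall m n, (m < n)%N -> (j m < j n)%N, dual_ball f &
    forall i, `|Psi g1| - eta <= (-1) ^+ i * (f (u (j i)) - f x)].
Proof.
move=> Psi cl bPsi ladd g1B eta0; pose r := `|Psi g1| - eta.
(* The reservoir stays cofinite, because the next index is dictated by [Phi] and the new
   functional. *)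
pose Q h (M : set nat) := (exists N, forall k, (N <= k)%N -> M k) /\
  exists2 g, dual_ball g & alternates u x r h g.
have [|||j [jlt _ jQ]] := fusion (Q := Q) (M0 := setT).
- by move=> N; exists N.
- by split; [exists 0%N|exists (fun=> 0) => //; apply: dual_ball0].
- move=> h M _ [[N MN] [g gB /alternates_open[e e0 eP]]].
  pose theta : R := (-1) ^+ size h.
  have th : `|theta| <= 1 by rewrite /theta normrX normrN1 expr1n.
  have e1 : 0 < Num.min e (eta / 2) by rewrite lt_min e0; lra.
  have [g' [g'B g'Psi g'g]] :=
    L_embedded_extension (x :: map u h) bPsi gB g1B th ladd e1.
  have [k + nk] := clust_near N cl g'B.1 (divr_gt0 eta0 (ltr0Sn R 1)).
  move=> lek; exists k, [set i | (k < i)%N]; split.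
  + exact: MN.
  + by move=> m; exists (maxn m k.+1) => /=; lia.
  + by move=> i /= lti; split=> //; apply: MN; lia.
  + split; first by exists k.+1.
    exists g' => //; split; last first.
      by apply: eP => y /g'g; rewrite lt_min => /andP[].
    move: nk g'Psi; rewrite lt_min !ltr_norml => /andP[n1 n2] /andP[_ /andP[p1 p2]].
    move: p1 p2 n1 n2; rewrite /r /theta /Psi /bsub /embed -signr_odd.
    by case: odd; rewrite ?expr1 ?expr0; lra.
have /choice[F FP] n : exists g, dual_ball g /\ alternates u x r (history j n) g.
  by have [M [_ [g gB gP]] _] := jQ n; exists g.
have [f fB fP] := dual_ball_limit (fun n => (FP n).1).
exists j, f; split=> // i.
(* The signed difference is the value of [g] at a single point, so its lower bound survives the
   limit. *)
have E g : dual_ball g ->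
    (-1) ^+ i * (g (u (j i)) - g x) = g ((-1) ^+ i *: (u (j i) - x)).
  by move=> gB; rewrite (dualZ _ _ gB.1) (dualD _ _ gB.1) (dualN _ gB.1).
rewrite E//; apply: fP; exists i.+1 => m lti; rewrite -E; last exact: (FP m).1.
by apply: ltW; apply: (alternates_history (FP m).2).
Qed.

(** The even and the odd terms have cluster points whose values at [f] are at least f x + r and at
    most f x - r. *)
Lemma alternating_deltaX u (C r : R) (j : nat -> nat) x f : (forall k, `|u k| <= C) ->
  (forall m n, (m < n)%N -> (j m < j n)%N) -> dual_ball f ->
  (forall i, r <= (-1) ^+ i * (f (u (j i)) - f x)) -> ((2 * r)%:E <= deltaX u)%E.
Proof.
move=> uC jlt fB fP.
have [Phi cPhi] := @clust_nonempty _ _ (u \o (fun n => j n.*2)) C (fun k => uC _).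
have [Psi cPsi] := @clust_nonempty _ _ (u \o (fun n => j n.*2.+1)) C (fun k => uC _).
have h1 : r + f x <= Phi f.
  apply: (clust_ge (N := 0) cPhi fB.1) => k _ /=.
  by have := fP k.*2; rewrite -signr_odd odd_double expr0; lra.
have h2 : Psi f <= f x - r.
  apply: (clust_le (N := 0) cPsi fB.1) => k _ /=.
  by have := fP k.*2.+1; rewrite -signr_odd /= odd_double expr1; lra.
apply: (@le_trans _ _ (bnorm (bsub Phi Psi))); last first.
  apply: ereal_sup_ubound; exists Phi, Psi; split; [|split=> //].
    by apply: (clust_subseq _ cPhi) => m n mn; apply: jlt; lia.
  by apply: (clust_subseq _ cPsi) => m n mn; apply: jlt; lia.
apply: le_trans (bnorm_ge _ fB); rewrite lee_fin /bsub.
by have := ler_norm (Phi f - Psi f); lra.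
Qed.

Lemma L_embedded_dhat_le u (C : R) : (forall k, `|u k| <= C) -> L_embedded X ->
  (2%:E * dhat_X (clust u) <= deltaX u)%E.
Proof.
move=> uC [P [Plin [Pid Padd]]].
rewrite -lee_pdivlMl//; apply: ge_ereal_sup => _ [Phi cl <-].
have [bPsi ladd] := L_embedded_complement Plin Pid Padd cl.1.
apply: (@le_trans _ _ (bnorm (bsub Phi (embed (P Phi))))).
  by apply: ereal_inf_lbound; exists (P Phi).
apply: bnorm_le => g1 g1B; rewrite lee_pdivlMl// -EFinM.
apply/lee_addgt0Pr => e e0.
have e2 : 0 < e / 2 by lra.
have [j [f [jlt fB fP]]] := L_embedded_alternating cl bPsi ladd g1B e2.
rewrite -leeBlDr// -EFinB; apply: le_trans (alternating_deltaX uC jlt fB fP).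
by rewrite lee_fin; lra.
Qed.

Lemma dset_X_subset A B : A `<=` B -> (@dset_X R X B <= dset_X A)%E.
Proof.
move=> AB; apply: ereal_inf_le_tmp => _ [Phi [x [APhi ->]]].
by exists Phi, x; split=> //; apply: AB.
Qed.

Lemma dset_X_le_dhat A : A !=set0 -> (@dset_X R X A <= dhat_X A)%E.
Proof.
move=> [Phi APhi]; apply: le_trans (dist_X_le_dhat APhi).
apply: ereal_inf_le_tmp => _ [x _ <-].
by exists Phi, x.
Qed.

(** A subsequence has fewer cluster points, hence a larger [dset_X], which is at most its [dhat_X];
    the preceding inequality is then applied to the subsequence. *)
Lemma L_embedded_dset_le u (C : R) : (forall k, `|u k| <= C) -> L_embedded X ->
  (2%:E * dset_X (clust u) <= delta_tilde u)%E.
Proof.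
move=> uC LX; apply: le_ereal_inf_tmp => _ [j jlt <-].
have ujC k : `|(u \o j) k| <= C by apply: uC.
apply: le_trans (L_embedded_dhat_le ujC LX); apply: lee_wpmul2l => //.
apply: le_trans (dset_X_subset (clust_subseq jlt)) _.
exact: dset_X_le_dhat (clust_nonempty ujC).
Qed.

End LEmbedded.

Theorem theorem1p1 (R : realType) (X : completeNormedModType R) (u : nat -> X)
  (hbdd : exists M : R, forall k, `|u k| <= M) :
  (delta_tilde u <= 2%:E * dhat_X (clust u))%E /\
  (L_embedded X ->
     (2%:E * dhat_X (clust u) <= deltaX u)%E /\
     (2%:E * dset_X (clust u) <= delta_tilde u)%E).
Proof.
have [C uC] := hbdd; split=> [|LX]; first exact: delta_tilde_le_dhat uC.
by split; [apply: L_embedded_dhat_le uC LX|apply: L_embedded_dset_le uC LX].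
Qed.
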